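(* Let $U:[-1,1]\to\mathbb{R}$ be twice continuously differentiable, let $\alpha>0$, $R>0$ and $\beta\in\mathbb{R}$, and suppose that $c=c_r+ic_i\in\mathbb{C}$ and a not identically zero function $\phi:[-1,1]\to\mathbb{C}$ satisfy $$(U-c)(D^2-\alpha^2)\phi-(D^2U-\beta)\phi=\frac{1}{i\alpha R}(D^2-\alpha^2)^2\phi\quad\text{on }[-1,1],\qquad \phi=D\phi=0\ \text{ at } z=\pm1 .$$ Then $$c_i\le \frac{q}{2\alpha}-\frac{1}{\alpha R}\left(\frac{\pi^2}{4}+\alpha^2\right),\qquad\text{where } q=\max_{z\in[-1,1]}|DU(z)| .$$
   Context: Here $D=d/dz$ is differentiation with respect to the real variable $z\in[-1,1]$, $(D^2-\alpha^2)\phi=\phi''-\alpha^2\phi$, and $(D^2-\alpha^2)^2\phi=\phi''''-2\alpha^2\phi''+\alpha^4\phi$. The function $\phi$ is complex valued and four times continuously differentiable (a classical solution). $c_r$ and $c_i$ are the real and imaginary parts of $c$. This is the eigenvalue problem for the linear stability of a viscous parallel shear flow $U$ in the $\beta$-plane, with wave number $\alpha$, Reynolds number $R$ and complex wave velocity $c$. *)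

(* Defs.v *)
From Stdlib Require Import Reals Lra.
From Coquelicot Require Import Coquelicot.
Open Scope R_scope.

Definition dom (z : R) : Prop := -1 <= z <= 1.

(** Derivative at [z] of [f] as a function on [dom] only: one-sided at the
    endpoints, and insensitive to the values of [f] outside [dom]. *)
Definition is_derive_dom {V : NormedModule R_AbsRing} (f : R -> V) (z : R) (l : V)
  : Prop :=
  filterdiff f (within dom (locally z)) (fun h : R => scal h l).

Definition ex_derive_dom {V : NormedModule R_AbsRing} (f : R -> V) (z : R) : Prop :=
  exists l : V, is_derive_dom f z l.

(** Meaningful only for [z] in [dom] with [ex_derive_dom f z]; see [D_unique]. *)
Definition D {V : CompleteNormedModule R_AbsRing} (f : R -> V) (z : R) : V :=
  iota (fun l : V => is_derive_dom f z l).

Definition Dn {V : CompleteNormedModule R_AbsRing} (n : nat) (f : R -> V) : R -> V :=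
  Nat.iter n D f.

Definition class_C {V : CompleteNormedModule R_AbsRing} (n : nat) (f : R -> V)
  : Prop :=
  (forall (k : nat) (z : R), (k < n)%nat -> dom z -> ex_derive_dom (Dn k f) z) /\
  continuous_on dom (Dn n f).

(** [C] is viewed as a normed space over the reals, so that functions [R -> C]
    are differentiated with respect to a real variable. *)
Notation D_R := (@D R_CompleteNormedModule).
Notation D_C := (@D C_R_CompleteNormedModule).
Notation Dn_R := (@Dn R_CompleteNormedModule).
Notation Dn_C := (@Dn C_R_CompleteNormedModule).
Notation class_C_R := (@class_C R_CompleteNormedModule).
Notation class_C_C := (@class_C C_R_CompleteNormedModule).

Definition is_max_on_dom (f : R -> R) (m : R) : Prop :=
  (exists z : R, dom z /\ f z = m) /\ (forall z : R, dom z -> f z <= m).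

Lemma dom_near (z : R) (d : posreal) :
  dom z -> exists y : R, dom y /\ y <> z /\ Rabs (y - z) < d.
Proof.
intros [H1 H2].
pose proof (cond_pos d) as Hd.
assert (Hm : 0 < Rmin (d / 2) 1) by (apply Rmin_pos; lra).
pose proof (Rmin_l (d / 2) 1); pose proof (Rmin_r (d / 2) 1).
destruct (Rle_dec z 0) as [Hz | Hz].
- exists (z + Rmin (d / 2) 1); unfold dom.
  repeat split; try lra.
  rewrite Rabs_pos_eq; lra.
- exists (z - Rmin (d / 2) 1); unfold dom.
  repeat split; try lra.
  rewrite Rabs_left; lra.
Qed.

Lemma minus_minus_cancel {G : AbelianGroup} (w a b : G) :
  minus (minus w b) (minus w a) = minus a b.
Proof.
rewrite (minus_trans w a b), <- (opp_minus w a).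
unfold minus at 1. rewrite plus_comm. reflexivity.
Qed.

Lemma norm_scal_ge {V : NormedModule R_AbsRing} (r : R) (v : V) :
  r <> 0 -> Rabs r * norm v <= norm (scal r v).
Proof.
intros Hr.
assert (E : scal (/ r) (scal r v) = v).
{ rewrite scal_assoc. change (mult (/ r) r) with (/ r * r).
  rewrite Rinv_l by exact Hr. exact (scal_one v). }
assert (Hle : norm v <= / Rabs r * norm (scal r v)).
{ rewrite <- E at 1. rewrite <- Rabs_inv. exact (norm_scal (/ r) (scal r v)). }
assert (Hr0 : 0 < Rabs r) by (apply Rabs_pos_lt; exact Hr).
apply (Rmult_le_compat_l (Rabs r)) in Hle; [| lra].
rewrite <- Rmult_assoc, Rinv_r, Rmult_1_l in Hle by lra.
exact Hle.
Qed.

Lemma is_derive_dom_inj {V : NormedModule R_AbsRing} (f : R -> V) (z : R) (l1 l2 : V) :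
  dom z -> is_derive_dom f z l1 -> is_derive_dom f z l2 -> l1 = l2.
Proof.
intros Iz [_ H1] [_ H2].
assert (Hlim : is_filter_lim (within dom (locally z)) z).
{ intros P HP. unfold within. revert HP. apply filter_imp. auto. }
specialize (H1 z Hlim). specialize (H2 z Hlim).
assert (H0 : norm (minus l1 l2) <= 0).
{ apply Rnot_lt_le; intros Hpos.
  assert (He : 0 < norm (minus l1 l2) / 4) by lra.
  specialize (H1 (mkposreal _ He)). specialize (H2 (mkposreal _ He)).
  destruct (filter_and _ _ H1 H2) as [d Hd].
  destruct (dom_near z d Iz) as (y & Iy & Hyz & Hy).
  destruct (Hd y Hy Iy) as [A0 B0].
  set (w := minus (f y) (f z)).
  assert (A : norm (minus w (scal (y - z) l1))
              <= norm (minus l1 l2) / 4 * Rabs (y - z)) by exact A0.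
  assert (B : norm (minus w (scal (y - z) l2))
              <= norm (minus l1 l2) / 4 * Rabs (y - z)) by exact B0.
  assert (E : scal (y - z) (minus l1 l2)
              = minus (minus w (scal (y - z) l2)) (minus w (scal (y - z) l1))).
  { symmetry.
    refine (eq_trans (minus_minus_cancel w (scal (y - z) l1) (scal (y - z) l2)) _).
    symmetry. exact (scal_minus_distr_l (y - z) l1 l2). }
  assert (Hn : Rabs (y - z) * norm (minus l1 l2)
               <= norm (scal (y - z) (minus l1 l2)))
    by (apply norm_scal_ge; lra).
  rewrite E in Hn.
  pose proof (norm_triangle (minus w (scal (y - z) l2))
    (opp (minus w (scal (y - z) l1)))) as T.
  rewrite norm_opp in T.
  pose proof (Rle_trans _ _ _ Hn T) as T'.
  assert (0 < Rabs (y - z)) by (apply Rabs_pos_lt; lra).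
  assert (0 < Rabs (y - z) * norm (minus l1 l2)) by (apply Rmult_lt_0_compat; lra).
  lra. }
assert (Hz : norm (minus l1 l2) = 0)
  by (apply Rle_antisym; [exact H0 | apply norm_ge_0]).
apply norm_eq_zero in Hz.
apply (plus_reg_r (opp l2)). rewrite plus_opp_r. exact Hz.
Qed.

Lemma D_unique {V : CompleteNormedModule R_AbsRing} (f : R -> V) (z : R) (l : V) :
  dom z -> is_derive_dom f z l -> D f z = l.
Proof.
intros Iz Hl. apply iota_unique; [| exact Hl].
intros l' Hl'. exact (is_derive_dom_inj f z l' l Iz Hl' Hl).
Qed.

(* Main.v *)
Require Import Defs.
From Stdlib Require Import Reals Lra Lia.
From Coquelicot Require Import Coquelicot.
Open Scope R_scope.

(** Write [S = |phi'|^2 + alpha^2 |phi|^2] and [P = 1 / (alpha R)].  For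
    [0 < k < pi/2] put [w = k tan (k z)], which is smooth on [[-1,1]] and satisfies
    [w' = k^2 + w^2], so that [|f'|^2 = k^2 |f|^2 - (w |f|^2)' + |f' + w f|^2] for
    every [f].  The imaginary part of the equation times the conjugate of [phi],
    combined with this identity for [f = phi] and [f = phi'], shows that a
    function [B] vanishing at both endpoints has
    [B' <= (q / (2 alpha) - c_i - P (k^2 + alpha^2)) S].  If the bracket were
    negative, [B] would be nonincreasing with equal endpoint values, so [B'] and
    hence [S] would vanish on [(-1,1)].  Finally [k] tends to [pi/2]. *)

(** The retraction of the line onto [[-1,1]]. Precomposing with it turns one-sided regularity at the
    endpoints into continuity on a full neighbourhood, and changes nothing on [dom]. *)
Definition clamp (z : R) : R := Rmax (-1) (Rmin 1 z).

Lemma clamp_dom (z : R) : dom (clamp z).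
Proof.
unfold dom, clamp, Rmax, Rmin; repeat destruct Rle_dec; lra.
Qed.

Lemma clamp_id (z : R) : dom z -> clamp z = z.
Proof.
unfold dom, clamp, Rmax, Rmin; repeat destruct Rle_dec; lra.
Qed.

Lemma clamp_contract (x y : R) : Rabs (clamp y - clamp x) <= Rabs (y - x).
Proof.
unfold clamp, Rmax, Rmin; repeat destruct Rle_dec;
  unfold Rabs; repeat destruct Rcase_abs; lra.
Qed.

Lemma is_filter_lim_within_dom (z : R) :
  is_filter_lim (within dom (locally z)) z.
Proof.
intros P HP; unfold within; revert HP; apply filter_imp; auto.
Qed.

Lemma is_derive_dom_interior {V : NormedModule R_AbsRing} (f : R -> V) (z : R) (l : V) :
  -1 < z < 1 -> is_derive_dom f z l -> is_derive f z l.
Proof.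
intros Hz [Hlin Hd]; split; [exact Hlin |].
intros x Hx.
apply (is_filter_lim_locally_unique (V := R_NormedModule)) in Hx; subst x.
intros eps.
specialize (Hd z (is_filter_lim_within_dom z) eps).
assert (Hdom : locally z dom).
{ apply (locally_interval dom z (-1) 1); simpl; try lra.
  intros y H1 H2; unfold dom; lra. }
unfold within in Hd.
generalize (filter_and (F := locally z) _ _ Hd Hdom); apply filter_imp.
intros y [H1 H2]; exact (H1 H2).
Qed.

Lemma is_derive_clamp (f : R -> R) (z l : R) :
  -1 < z < 1 -> is_derive_dom f z l -> is_derive (fun x => f (clamp x)) z l.
Proof.
intros Hz Hl.
apply (is_derive_ext_loc f).
- apply (locally_interval _ z (-1) 1); simpl; try lra.
  intros y H1 H2; rewrite clamp_id; [reflexivity | unfold dom; lra].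
- now apply is_derive_dom_interior.
Qed.

(** Being 1-Lipschitz with values in [dom], [clamp] carries neighbourhoods of [z] into relative
    neighbourhoods of [clamp z], where differentiability within [dom] gives continuity. *)
Lemma continuous_clamp (f : R -> R) (z : R) :
  (forall y, dom y -> ex_derive_dom f y) -> continuity_pt (fun x => f (clamp x)) z.
Proof.
intros Hf; apply continuity_pt_filterlim.
apply (filterlim_comp _ _ _ clamp f _ (within dom (locally (clamp z)))).
- intros P [d Hd]; exists d; intros y Hy.
  apply Hd; [| apply clamp_dom].
  apply Rle_lt_trans with (2 := Hy); apply clamp_contract.
- destruct (Hf (clamp z) (clamp_dom z)) as [l Hl].
  apply (filterdiff_continuous_aux (U := R_NormedModule) (V := R_NormedModule) f).
  + eexists; exact Hl.
  + apply is_filter_lim_within_dom.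
Qed.

Lemma D_correct {V : CompleteNormedModule R_AbsRing} (f : R -> V) (z : R) :
  dom z -> ex_derive_dom f z -> is_derive_dom f z (Defs.D f z).
Proof.
intros Iz [l Hl]; now rewrite (D_unique f z l Iz Hl).
Qed.

(** Used with [Re] and [Im] to split the derivatives of [phi] into real functions. *)
Lemma is_derive_dom_linear (L : C -> R) (f : R -> C) (z : R) (l : C) :
  is_linear (U := C_R_NormedModule) L ->
  is_derive_dom (V := C_R_NormedModule) f z l ->
  is_derive_dom (fun x => L (f x)) z (L l).
Proof.
intros HL Hl; unfold is_derive_dom.
apply (filterdiff_ext_lin _ (fun h : R => L (scal (V := C_R_NormedModule) h l))).
- apply (filterdiff_comp (V := C_R_NormedModule) f L _ L Hl).
  now apply filterdiff_linear.
- intros h; apply (linear_scal (U := C_R_NormedModule) L HL).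
Qed.

(** By the mean value theorem [f] is nonincreasing, so it is squeezed between its equal endpoint
    values and is constant. *)
Lemma nonincreasing_equal_endpoints (f df : R -> R) (a b : R) :
  (forall x, a < x < b -> is_derive f x (df x)) ->
  (forall x, a <= x <= b -> continuity_pt f x) ->
  (forall x, a <= x <= b -> df x <= 0) ->
  f a = f b ->
  forall x, a < x < b -> df x = 0.
Proof.
intros Hd Hc Hneg Hend.
assert (Hmono : forall x y, a <= x -> x <= y -> y <= b -> f y <= f x).
{ intros x y Hx Hxy Hy.
  destruct (MVT_gen f x y df) as [u [Hu Hu']];
    rewrite ?Rmin_left, ?Rmax_right in * by lra.
  - intros t Ht; apply Hd; lra.
  - intros t Ht; apply Hc; lra.
  - specialize (Hneg u ltac:(lra)); nra. }
intros x Hx.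
rewrite <- (is_derive_unique f x (df x)) by now apply Hd.
apply is_derive_unique.
apply (is_derive_ext_loc (fun _ => f a)); [| apply @is_derive_const].
apply (locally_interval _ x a b); simpl; try lra.
intros y Hy1 Hy2.
pose proof (Hmono a y); pose proof (Hmono y b); lra.
Qed.

(** [a n + i b n] stands for the [n]-th derivative of [phi]; [hre] and [him] are the
    real and imaginary parts of the equation. *)
Lemma mode_growth_bound (U U1 : R -> R) (a b : nat -> R -> R)
  (be : R -> R) (al P q k cr ci : R)
  (hk : 0 < k < PI / 2) (hal : 0 < al) (hP : 0 < P)
  (hU : forall z, -1 < z < 1 -> is_derive U z (U1 z))
  (cU : forall z, dom z -> continuity_pt U z)
  (ha : forall n z, (n < 4)%nat -> -1 < z < 1 -> is_derive (a n) z (a (S n) z))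
  (hb : forall n z, (n < 4)%nat -> -1 < z < 1 -> is_derive (b n) z (b (S n) z))
  (ca : forall n z, (n < 4)%nat -> dom z -> continuity_pt (a n) z)
  (cb : forall n z, (n < 4)%nat -> dom z -> continuity_pt (b n) z)
  (hne : exists z, -1 < z < 1 /\ (a 0%nat z <> 0 \/ b 0%nat z <> 0))
  (bcl : a 0%nat (-1) = 0 /\ b 0%nat (-1) = 0 /\ a 1%nat (-1) = 0 /\ b 1%nat (-1) = 0)
  (bcr : a 0%nat 1 = 0 /\ b 0%nat 1 = 0 /\ a 1%nat 1 = 0 /\ b 1%nat 1 = 0)
  (hq : forall z, dom z -> Rabs (U1 z) <= q)
  (hre : forall z, dom z ->
     (U z - cr) * (a 2%nat z - al ^ 2 * a 0%nat z)
       + ci * (b 2%nat z - al ^ 2 * b 0%nat z) - be z * a 0%nat z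
     = P * (b 4%nat z - 2 * al ^ 2 * b 2%nat z + al ^ 4 * b 0%nat z))
  (him : forall z, dom z ->
     (U z - cr) * (b 2%nat z - al ^ 2 * b 0%nat z)
       - ci * (a 2%nat z - al ^ 2 * a 0%nat z) - be z * b 0%nat z
     = - P * (a 4%nat z - 2 * al ^ 2 * a 2%nat z + al ^ 4 * a 0%nat z)) :
  ci <= q / (2 * al) - P * (k ^ 2 + al ^ 2).
Proof.
apply Rnot_lt_le; intros Hlt.
set (w := fun z => k * tan (k * z)).
(* The first three groups are the boundary terms left by integrating by parts the imaginary part of
   the equation times the conjugate of [phi]; the last, [- P w S], collects the terms
   [(w |f|^2)']. *)
set (B := fun z =>
  (U z - cr) * (b 1%nat z * a 0%nat z - a 1%nat z * b 0%nat z)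
  - (ci + 2 * P * al ^ 2) * (a 1%nat z * a 0%nat z + b 1%nat z * b 0%nat z)
  + P * (a 3%nat z * a 0%nat z + b 3%nat z * b 0%nat z
         - a 2%nat z * a 1%nat z - b 2%nat z * b 1%nat z)
  - P * w z * (a 1%nat z ^ 2 + b 1%nat z ^ 2
               + al ^ 2 * (a 0%nat z ^ 2 + b 0%nat z ^ 2))).
set (S := fun z => a 1%nat z ^ 2 + b 1%nat z ^ 2
               + al ^ 2 * (a 0%nat z ^ 2 + b 0%nat z ^ 2)).
set (dB := fun z =>
  U1 z * (b 1%nat z * a 0%nat z - a 1%nat z * b 0%nat z)
  - (ci + P * (k ^ 2 + al ^ 2)) * S z
  - P * ((a 2%nat z + w z * a 1%nat z) ^ 2 + (b 2%nat z + w z * b 1%nat z) ^ 2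
         + al ^ 2 * ((a 1%nat z + w z * a 0%nat z) ^ 2
                     + (b 1%nat z + w z * b 0%nat z) ^ 2))).
assert (HS : forall z, 0 <= S z) by (intros z; unfold S; nra).
assert (Hcos : forall z, dom z -> cos (k * z) <> 0).
{ intros z [Hz1 Hz2]; apply Rgt_not_eq, cos_gt_0; nra. }
assert (Hw : forall z, dom z -> is_derive w z (k ^ 2 + w z ^ 2)).
{ intros z Iz; assert (Ht := is_derive_tan (k * z) (Hcos z Iz)).
  assert (Ht' : Derive (fun x => tan x) (k * z) = tan (k * z) ^ 2 + 1)
    by exact (is_derive_unique _ _ _ Ht).
  unfold w; auto_derive; [eexists; exact Ht |].
  rewrite Ht'; ring. }
(* From here on only the Riccati equation [w' = k^2 + w^2] is used. *)
clearbody w.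
assert (HdB : forall z, dom z ->
  dB z <= (q / (2 * al) - (ci + P * (k ^ 2 + al ^ 2))) * S z).
{ intros z Iz; specialize (hq z Iz).
  assert (H1 : U1 z * (b 1%nat z * a 0%nat z - a 1%nat z * b 0%nat z)
               <= q * Rabs (b 1%nat z * a 0%nat z - a 1%nat z * b 0%nat z)).
  { apply Rle_trans with (1 := Rle_abs _); rewrite Rabs_mult.
    apply Rmult_le_compat_r; [apply Rabs_pos | exact hq]. }
  (* This is [2 alpha |Im(conj(phi) phi')| <= S], by expanding [|phi' + i alpha phi|^2 >= 0] or
     [|phi' - i alpha phi|^2 >= 0] according to the sign. *)
  assert (H2 : Rabs (b 1%nat z * a 0%nat z - a 1%nat z * b 0%nat z)
               <= / (2 * al) * S z).
  { apply (Rmult_le_reg_l (2 * al)); [lra |].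
    rewrite <- Rmult_assoc, Rinv_r, Rmult_1_l by lra.
    unfold S, Rabs; destruct Rcase_abs.
    - pose proof (pow2_ge_0 (al * a 0%nat z + b 1%nat z)).
      pose proof (pow2_ge_0 (al * b 0%nat z - a 1%nat z)); nra.
    - pose proof (pow2_ge_0 (al * a 0%nat z - b 1%nat z)).
      pose proof (pow2_ge_0 (al * b 0%nat z + a 1%nat z)); nra. }
  assert (Hq0 : 0 <= q) by (pose proof (Rabs_pos (U1 z)); lra).
  apply (Rmult_le_compat_l q) in H2; [| exact Hq0].
  unfold dB; unfold Rdiv.
  (* [X] is the sum of the squares [|f' + w f|^2] for [f = phi'] and, weighted by [al ^ 2], for
     [f = phi]. *)
  match goal with |- _ - _ - P * ?X <= _ => assert (0 <= X) end.
  { pose proof (pow2_ge_0 al).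
    repeat apply Rplus_le_le_0_compat; try apply pow2_ge_0.
    apply Rmult_le_pos; [assumption |].
    apply Rplus_le_le_0_compat; apply pow2_ge_0. }
  nra. }
assert (HB : forall z, -1 < z < 1 -> is_derive B z (dB z)).
{ intros z Hz.
  assert (Iz : dom z) by (unfold dom; lra).
  assert (hw := Hw z Iz).
  assert (hUz := hU z Hz).
  assert (Ha := fun n Hn => ha n z Hn Hz); assert (Hb := fun n Hn => hb n z Hn Hz).
  unfold B; auto_derive.
  - repeat apply conj; try exact I;
    eexists; lazymatch goal with
      | |- is_derive (fun x => a _ x) _ _ => apply Ha; lia
      | |- is_derive (fun x => b _ x) _ _ => apply Hb; lia
      | |- _ => eassumption
      end.
  - assert (EU : Derive (fun x => U x) z = U1 z)
      by exact (is_derive_unique _ _ _ hUz).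
    assert (Ew : Derive (fun x => w x) z = k ^ 2 + w z ^ 2)
      by exact (is_derive_unique _ _ _ hw).
    assert (Ea : forall n, (n < 4)%nat -> Derive (fun x => a n x) z = a (Datatypes.S n) z)
      by (intros n Hn; exact (is_derive_unique _ _ _ (Ha n Hn))).
    assert (Eb : forall n, (n < 4)%nat -> Derive (fun x => b n x) z = b (Datatypes.S n) z)
      by (intros n Hn; exact (is_derive_unique _ _ _ (Hb n Hn))).
    rewrite EU, Ew, !Ea, !Eb by lia.
    specialize (hre z Iz); specialize (him z Iz).
    (* [a 0] times [him] minus [b 0] times [hre] is the imaginary part of the equation times the
       conjugate of [phi]; the [be] terms cancel in it. *)
    apply (f_equal (Rmult (b 0%nat z))) in hre.
    apply (f_equal (Rmult (a 0%nat z))) in him.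
    unfold dB, S; lra. }
assert (HBc : forall z, -1 <= z <= 1 -> continuity_pt B z).
{ intros z Iz; change (dom z) in Iz.
  assert (hw : continuity_pt w z).
  { apply derivable_continuous_pt; exists (k ^ 2 + w z ^ 2); apply is_derive_Reals.
    now apply Hw. }
  assert (cUz := cU z Iz).
  assert (ca0 := ca 0%nat z ltac:(lia) Iz); assert (cb0 := cb 0%nat z ltac:(lia) Iz).
  assert (ca1 := ca 1%nat z ltac:(lia) Iz); assert (cb1 := cb 1%nat z ltac:(lia) Iz).
  assert (ca2 := ca 2%nat z ltac:(lia) Iz); assert (cb2 := cb 2%nat z ltac:(lia) Iz).
  assert (ca3 := ca 3%nat z ltac:(lia) Iz); assert (cb3 := cb 3%nat z ltac:(lia) Iz).
  unfold B; reg. }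
assert (HdB0 : forall z, -1 <= z <= 1 -> dB z <= 0).
{ intros z Hz; apply Rle_trans with (1 := HdB z Hz); specialize (HS z); nra. }
destruct hne as [z [Hz Hnz]].
(* Every term of [B] has a factor [phi] or [phi'], so both values are zero. *)
assert (Hend : B (-1) = B 1).
{ unfold B; destruct bcl as (-> & -> & -> & ->); destruct bcr as (-> & -> & -> & ->); ring. }
pose proof (nonincreasing_equal_endpoints B dB (-1) 1 HB HBc HdB0 Hend z Hz) as Hz0.
pose proof (HdB z ltac:(unfold dom; lra)) as HdBz.
(* Where [phi] is nonzero, [S >= al^2 |phi|^2 > 0], so the strictly negative bracket makes [dB z]
   negative, against [Hz0]. *)
assert (0 < S z); [| nra].
assert (0 < al ^ 2) by nra.
unfold S.
destruct Hnz as [H1 | H1]; apply pow2_gt_0 in H1; nra.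
Qed.

Lemma inv_i_alpha_R (al r : R) : 0 < al -> 0 < r ->
  (RtoC 1 / (Ci * RtoC al * RtoC r))%C = (0, - (1 / (al * r))).
Proof.
intros Hal Hr.
assert (H : (Ci * RtoC al * RtoC r)%C = (0, al * r))
  by (apply injective_projections; simpl; ring).
rewrite H.
apply injective_projections; simpl; field; nra.
Qed.

Theorem theorem3 (U : R -> R) (alpha Rey beta : R) (c : C) (phi : R -> C) (q : R)
  (hU : class_C_R 2 U)
  (halpha : 0 < alpha)
  (hRey : 0 < Rey)
  (hphi : class_C_C 4 phi)
  (hphi_neq0 : exists z : R, dom z /\ phi z <> RtoC 0)
  (hode : forall z : R, dom z ->
     ((RtoC (U z) - c) * (Dn_C 2 phi z - RtoC (alpha ^ 2) * phi z)
        - RtoC (Dn_R 2 U z - beta) * phi z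
      = RtoC 1 / (Ci * RtoC alpha * RtoC Rey)
          * (Dn_C 4 phi z - RtoC (2 * alpha ^ 2) * Dn_C 2 phi z
               + RtoC (alpha ^ 4) * phi z))%C)
  (hbc_left : phi (-1) = RtoC 0 /\ D_C phi (-1) = RtoC 0)
  (hbc_right : phi 1 = RtoC 0 /\ D_C phi 1 = RtoC 0)
  (hq : is_max_on_dom (fun z => Rabs (D_R U z)) q) :
  Im c <= q / (2 * alpha) - 1 / (alpha * Rey) * (PI ^ 2 / 4 + alpha ^ 2).
Proof.
set (P := 1 / (alpha * Rey)).
assert (hP : 0 < P) by (apply Rdiv_lt_0_compat; nra).
destruct hU as [dU _], hphi as [dphi _].
assert (HRe : is_linear (U := C_R_NormedModule) Re) by apply @is_linear_fst.
assert (HIm : is_linear (U := C_R_NormedModule) Im) by apply @is_linear_snd.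
assert (dphi' : forall n z, (n < 4)%nat -> dom z ->
  is_derive_dom (V := C_R_NormedModule) (Dn_C n phi) z (Dn_C (S n) phi z)).
{ intros n z Hn Iz; exact (D_correct (Dn_C n phi) z Iz (dphi n z Hn Iz)). }
assert (dU' : forall z, dom z -> is_derive_dom U z (D_R U z)).
{ intros z Iz; exact (D_correct U z Iz (dU 0%nat z ltac:(lia) Iz)). }
(* At [k = PI / 2] the function [k tan (k z)] would blow up at [z = 1] and [z = -1], so the bound is
   first proved for smaller [k]. *)
assert (Hk : forall k, 0 < k < PI / 2 ->
  Im c <= q / (2 * alpha) - P * (k ^ 2 + alpha ^ 2)).
{ intros k Hk.
  apply (mode_growth_bound (fun z => U (clamp z)) (fun z => D_R U (clamp z))
    (fun n z => Re (Dn_C n phi (clamp z))) (fun n z => Im (Dn_C n phi (clamp z)))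
    (fun z => Dn_R 2 U z - beta) alpha P q k (Re c) (Im c) Hk halpha hP).
  - intros z Hz.
    assert (Iz : dom z) by (unfold dom; lra).
    rewrite (clamp_id z Iz); now apply is_derive_clamp, dU'.
  - intros z _; apply continuous_clamp; intros y Iy; eexists; now apply dU'.
  - intros n z Hn Hz.
    assert (Iz : dom z) by (unfold dom; lra).
    rewrite (clamp_id z Iz).
    apply (is_derive_clamp (fun y => Re (Dn_C n phi y))); [exact Hz |].
    now apply is_derive_dom_linear, dphi'.
  - intros n z Hn Hz.
    assert (Iz : dom z) by (unfold dom; lra).
    rewrite (clamp_id z Iz).
    apply (is_derive_clamp (fun y => Im (Dn_C n phi y))); [exact Hz |].
    now apply is_derive_dom_linear, dphi'.
  - intros n z Hn _; apply (continuous_clamp (fun y => Re (Dn_C n phi y))).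
    intros y Iy; eexists; now apply is_derive_dom_linear, dphi'.
  - intros n z Hn _; apply (continuous_clamp (fun y => Im (Dn_C n phi y))).
    intros y Iy; eexists; now apply is_derive_dom_linear, dphi'.
  - destruct hphi_neq0 as [z [Iz Hz]]; exists z.
    rewrite (clamp_id z Iz); simpl.
    split.
    (* A point where [phi] is nonzero is interior, by the boundary conditions. *)
    + destruct Iz as [[Hl | Hl] [Hr | Hr]]; subst; try tauto; lra.
    + destruct (Req_dec (Re (phi z)) 0) as [H | H]; [right | now left].
      intros H'; apply Hz, injective_projections; assumption.
  - rewrite clamp_id by (unfold dom; lra).
    destruct hbc_left as [H0 H1].
    change (Dn_C 0 phi) with phi; change (Dn_C 1 phi) with (D_C phi).
    rewrite H0, H1; simpl; auto.
  - rewrite clamp_id by (unfold dom; lra).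
    destruct hbc_right as [H0 H1].
    change (Dn_C 0 phi) with phi; change (Dn_C 1 phi) with (D_C phi).
    rewrite H0, H1; simpl; auto.
  - intros z Iz; rewrite (clamp_id z Iz); now apply hq.
  - intros z Iz; rewrite (clamp_id z Iz).
    assert (E := f_equal Re (hode z Iz)).
    rewrite inv_i_alpha_R in E by assumption; fold P in E.
    change (Dn_C 0 phi) with phi; unfold Re, Im in *.
    cbn -[Dn pow] in E |- *.
    lra.
  - intros z Iz; rewrite (clamp_id z Iz).
    assert (E := f_equal Im (hode z Iz)).
    rewrite inv_i_alpha_R in E by assumption; fold P in E.
    change (Dn_C 0 phi) with phi; unfold Re, Im in *.
    cbn -[Dn pow] in E |- *.
    lra. }
apply le_epsilon; intros eps Heps.
assert (HPI := PI_RGT_0).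
(* For [k = PI / 2 - t] the loss is [P (PI^2 / 4 - k^2) = P (PI t - t^2) <= P PI t <= eps]; the cap
   [PI / 4] keeps [k] positive. *)
set (t := Rmin (PI / 4) (eps / (P * PI))).
assert (Ht0 : 0 < t).
{ apply Rmin_pos; [lra |]. apply Rdiv_lt_0_compat; nra. }
assert (Ht1 : t <= PI / 4) by apply Rmin_l.
assert (Ht2 : t * (P * PI) <= eps).
{ apply Rle_trans with (eps / (P * PI) * (P * PI)).
  - apply Rmult_le_compat_r; [nra | apply Rmin_r].
  - right; field; lra. }
specialize (Hk (PI / 2 - t) ltac:(lra)).
nra.
Qed.
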